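(* Let $N$ be a positive integer. For every set $S\subseteq[N]$ there exists a super edge, denoted $\mathsf{SparseLoad}_S$, loading $S$, such that for every input $z\in\{0,1\}^N$ $$c^0(\mathsf{SparseLoad}_S,z)\le 6\,|S|\,(|z_S|+1)\,\log(|S|+1)\quad\text{and}\quad c^1(\mathsf{SparseLoad}_S,z)\le 1,$$ where $|z_S|$ is the Hamming weight of $z_S$ and $\log$ is the natural logarithm.
   Context: For $S\subseteq[N]$, $z_S$ is the restriction of $z\in\{0,1\}^N$ to positions in $S$. A super edge loading $S$ is an extended learning graph, on inputs $Z=\{0,1\}^N$, all of whose flows have the same unique sink, this sink being a vertex labelled by $S$. Here it is not tied to a particular set of positive inputs, so it consists of: (i) a finite directed acyclic graph $(\mathcal V,\mathcal E)$ with a root $r$; (ii) a labelling $\mathcal S:\mathcal V\to 2^{[N]}$ with $\mathcal S(r)=\emptyset$ and, for every $(u,v)\in\mathcal E$, $\mathcal S(v)=\mathcal S(u)\cup\{j\}$ for some $j\notin\mathcal S(u)$; (iii) weights $w_z^b(u,v)\in\mathbb R_{\ge0}$ for $z\in\{0,1\}^N$, $b\in\{0,1\}$, $(u,v)\in\mathcal E$, depending on $z$ only through $z_{\mathcal S(v)}$; (iv) $w_x^0(u,v)=w_y^1(u,v)$ for all $x,y\in\{0,1\}^N$ and all $(u,v)\in\mathcal E$ with $\mathcal S(v)=\mathcal S(u)\cup\{j\}$, $x_{\mathcal S(u)}=y_{\mathcal S(u)}$ and $x_j\neq y_j$; (v) for each $z\in\{0,1\}^N$, a unit flow $p_z:\mathcal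 E\to\mathbb R_{\ge0}$ from the root to the unique sink (labelled $S$, the same for all $z$), with $p_z(e)=0$ whenever $w_z^1(e)=0$. (For $S=\emptyset$ the graph may be reduced to its root, with trivial flow and zero complexities.) Its negative and positive edge-complexities on $z$ are $c^0(\cdot,z)=\sum_{e\in\mathcal E}w_z^0(e)$ and $c^1(\cdot,z)=\sum_{e\in\mathcal E}p_z(e)^2/w_z^1(e)$ (terms with $p_z(e)=0$ count as $0$). *)

(* Defs.v *)
From HB Require Import structures.
From mathcomp Require Import all_boot all_order all_algebra.
From mathcomp Require Import reals exp.

Set Implicit Arguments.
Unset Strict Implicit.
Unset Printing Implicit Defensive.

Import Order.TTheory GRing.Theory Num.Theory.
Local Open Scope ring_scope.

Definition input (N : nat) := {ffun 'I_N -> bool}.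

(* |z_S|; equality of restrictions x_S = y_S is written {in S, x =1 y}. *)
Definition hamming N (S : {set 'I_N}) (z : input N) : nat :=
  #|[set i in S | z i]|.

(* Weights are total functions of two vertices, but only their values on edges
   are constrained or used; the superscript b is a boolean (false for 0, true
   for 1). *)
Record learningGraph (R : realType) (N : nat) := LearningGraph {
  vertex : finType;
  edge : rel vertex;
  root : vertex;
  label : vertex -> {set 'I_N};
  weight : input N -> bool -> vertex -> vertex -> R;
  edge_acyclic : forall u v, edge u v -> ~~ connect edge v u;
  root_connect : forall v, connect edge root v;
  label_root : label root = set0;
  label_edge : forall u v, edge u v ->
    exists2 j, j \notin label u & label v = j |: label u;
  weight_ge0 : forall z b u v, edge u v -> 0 <= weight z b u v;
  weight_local : forall (x y : input N) b u v, edge u v ->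
    {in label v, x =1 y} -> weight x b u v = weight y b u v;
  weight_swap : forall (x y : input N) u v j, edge u v ->
    label v = j |: label u -> {in label u, x =1 y} -> x j != y j ->
    weight x false u v = weight y true u v
}.

(* Outflow minus inflow is 1 at s, -1 at t and 0 elsewhere; when s = t it is 0
   everywhere, so that on an acyclic graph the flow vanishes. *)
Definition unit_flow (R : realType) (V : finType) (E : rel V) (s t : V)
    (p : V -> V -> R) : Prop :=
  (forall u v, E u v -> 0 <= p u v) /\
  (forall u, \sum_(v | E u v) p u v - \sum_(v | E v u) p v u =
             (u == s)%:R - (u == t)%:R).

Record superEdge (R : realType) (N : nat) (S : {set 'I_N}) := SuperEdge {
  graph :> learningGraph R N;
  sink : vertex graph;
  flow : input N -> vertex graph -> vertex graph -> R;
  label_sink : label sink = S;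
  flow_unit : forall z, unit_flow (@edge _ _ graph) (root graph) sink (flow z);
  flow_weight : forall z u v, edge u v ->
    weight z true u v = 0 -> flow z u v = 0
}.

Definition neg_complexity (R : realType) (N : nat) (S : {set 'I_N})
    (G : superEdge R S) (z : input N) : R :=
  \sum_(e : vertex G * vertex G | edge e.1 e.2) weight z false e.1 e.2.

(* Since 0^-1 = 0, terms with zero flow count as 0 even if the weight is 0. *)
Definition pos_complexity (R : realType) (N : nat) (S : {set 'I_N})
    (G : superEdge R S) (z : input N) : R :=
  \sum_(e : vertex G * vertex G | edge e.1 e.2)
    flow z e.1 e.2 ^+ 2 / weight z true e.1 e.2.

(* Main.v *)
(** Load the elements of [S] one at a time along a path carrying the constant
    unit flow.  On the edge loading [j], when [k] ones have been seen before, the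
    weight is [4 (k + 1) ln (#|S| + 1)] if [z j = b] and [2 #|S|] otherwise.
    The edges reading a 0 then contribute at most [1/2] to the positive
    complexity, and the edges reading a 1 contribute at most
    [\sum_k (4 (k + 1) ln (#|S| + 1))^-1 <= 1/2], as the harmonic sum up to [#|S|]
    is at most [2 ln (#|S| + 1)].  In the negative complexity each of the at most
    [#|S|] zeros costs at most [4 (|z_S| + 1) ln (#|S| + 1)] and each one costs
    [2 #|S|]. *)

Require Import Defs.
From mathcomp Require Import all_boot all_order all_algebra.
From mathcomp Require Import reals exp.
From mathcomp Require Import ring lra.

Import Order.TTheory GRing.Theory Num.Theory.
Local Open Scope ring_scope.

(** * Estimates for sums of weights along a path *)

Lemma ln_ge_1BV (R : realType) (x : R) : 0 < x -> 1 - x^-1 <= ln x.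
Proof.
move=> x0; have : ln (x^-1) <= x^-1 - 1.
  have xV0 : 0 < x^-1 by rewrite invr_gt0.
  rewrite -[X in ln X](subrKC 1); apply: le_ln1Dx; lra.
rewrite lnV ?posrE //; lra.
Qed.

(* [h] and [h'] count the ones seen before and after the edge, so that
   [(h < h')%N] is the bit read. *)
Definition sparse_weight (R : realType) (s h h' : nat) (b : bool) : R :=
  if (h < h')%N == b then 4 * (h%:R + 1) * ln (s%:R + 1) else 2 * s%:R.

Lemma ln_succ_gt0 (R : realType) (s : nat) : (0 < s)%N -> 0 < ln (s%:R + 1 : R).
Proof. by move=> s0; rewrite ln_gt0 // ltrDr ltr0n. Qed.

Lemma sparse_weight_gt0 (R : realType) (s h h' : nat) (b : bool) :
  (0 < s)%N -> 0 < sparse_weight R s h h' b.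
Proof.
move=> s0; rewrite /sparse_weight; case: ifP => _.
  by rewrite !mulr_gt0 ?ln_succ_gt0 // ltr_wpDl.
by rewrite mulr_gt0 // ltr0n.
Qed.

(** Induction on [n]: a last edge reading a 0 is paid for by the growth of [n], one reading a 1 by
    the growth of [h n]. *)
Lemma sum_sparse_weight_neg (R : realType) (s n : nat) (h : nat -> nat) :
  (0 < s)%N -> h 0%N = 0%N ->
  (forall i, (i < n)%N -> (h i <= h i.+1 <= (h i).+1)%N) ->
  \sum_(i < n) sparse_weight R s (h i) (h i.+1) false
    <= 4 * n%:R * ((h n)%:R + 1) * ln (s%:R + 1) + 2 * s%:R * (h n)%:R.
Proof.
move=> s0 h0; have L0 := ln_succ_gt0 R s s0.
elim: n => [|n IHn] hS; first by rewrite big_ord0 h0 !(mulr0, mul0r) addr0.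
rewrite big_ord_recr /= /sparse_weight.
have n0 : 0 <= n%:R :> R by [].
have hn0 : 0 <= (h n)%:R :> R by [].
have hsn i : (i < n)%N -> (h i <= h i.+1 <= (h i).+1)%N by move/ltnW/hS.
have := IHn hsn; move: (hS n (leqnn _)) => /andP[].
rewrite leq_eqVlt => /orP[/eqP <- _|lt_h le_h].
  by rewrite ltnn /= -[n.+1]addn1 natrD; lra.
have -> : h n.+1 = (h n).+1 by apply/eqP; rewrite eqn_leq le_h lt_h.
rewrite ltnSn /= -[n.+1]addn1 -[(h n).+1]addn1 !natrD => IH.
apply: le_trans (lerD IH (lexx _)) _.
(* With [L = ln (s + 1)], the slack is [4 (n + h n + 2) L]. *)
have := mulr_ge0 n0 (ltW L0); have := mulr_ge0 hn0 (ltW L0); nra.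
Qed.

(** The harmonic sum over the ones is replaced by increments of [ln], which telescope to
    [ln (h n + 1)]; each zero adds [1 / (2 s)]. *)
Lemma sum_sparse_weight_pos (R : realType) (s n : nat) (h : nat -> nat) :
  (0 < s)%N -> h 0%N = 0%N ->
  (forall i, (i < n)%N -> (h i <= h i.+1 <= (h i).+1)%N) ->
  \sum_(i < n) (sparse_weight R s (h i) (h i.+1) true)^-1
    <= n%:R / (2 * s%:R) + ln ((h n)%:R + 1) / (2 * ln (s%:R + 1)).
Proof.
move=> s0 h0; have L0 := ln_succ_gt0 R s s0.
elim: n => [|n IHn] hS; first by rewrite big_ord0 h0 add0r ln1 !mul0r addr0.
rewrite big_ord_recr /= /sparse_weight.
have sV0 : 0 < (2 * s%:R : R)^-1 by rewrite invr_gt0 mulr_gt0 ?ltr0n.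
have hn0 : 0 <= (h n)%:R :> R by [].
have hsn i : (i < n)%N -> (h i <= h i.+1 <= (h i).+1)%N by move/ltnW/hS.
have := IHn hsn; move: (hS n (leqnn _)) => /andP[].
rewrite leq_eqVlt => /orP[/eqP <- _|lt_h le_h].
  by rewrite ltnn /= -[n.+1]addn1 natrD => IH; lra.
have -> : h n.+1 = (h n).+1 by apply/eqP; rewrite eqn_leq le_h lt_h.
rewrite ltnSn /= -[n.+1]addn1 -[(h n).+1]addn1 !natrD => IH.
set k : R := (h n)%:R in hn0 IH *; set L := ln _ in L0 IH *.
have k1 : 0 < k + 1 by lra.
have k2 : 0 < k + 1 + 1 by lra.
(* Since [k + 2 <= 2 (k + 1)], the left side is at most [1 / (k + 2)], which [ln_ge_1BV] bounds by
   the logarithm of the quotient. *)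
have step : (2 * (k + 1))^-1 <= ln (k + 1 + 1) - ln (k + 1).
  rewrite -ln_div ?posrE //.
  apply: le_trans (ln_ge_1BV _ _ (divr_gt0 k2 k1)).
  have -> : 1 - ((k + 1 + 1) / (k + 1))^-1 = (k + 1 + 1)^-1.
    by field; rewrite !gt_eqF.
  by rewrite lef_pV2 ?posrE; lra.
have -> : (4 * (k + 1) * L)^-1 = (2 * (k + 1))^-1 / (2 * L).
  by field; rewrite !gt_eqF.
have := ler_wpM2r (ltW (_ : 0 < (2 * L)^-1)) step.
rewrite invr_gt0 mulr_gt0 // => /(_ isT); lra.
Qed.

(** * The directed path and its unit flow *)

Lemma sum_path_edges (R : nmodType) (s : nat) (F : nat -> nat -> R) :
  \sum_(e : 'I_s.+1 * 'I_s.+1 | e.2 == e.1.+1 :> nat) F e.1 e.2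
    = \sum_(i < s) F i i.+1.
Proof.
rewrite -(pair_big_dep xpredT (fun u v : 'I_s.+1 => v == u.+1 :> nat)
  (fun u v => F u v)) /=.
(* The last vertex has no outgoing edge. *)
rewrite big_ord_recr /= [X in _ + X]big_pred0 ?addr0; last first.
  by move=> v; rewrite ltn_eqF.
apply: eq_bigr => i _; rewrite (big_pred1 (lift ord0 i)) //.
Qed.

(** The outflow is 1 except at the last vertex and the inflow is 1 except at the root; this covers
    [s = 0], where the two coincide. *)
Lemma path_unit_flow (R : realType) (s : nat) :
  unit_flow (R := R) (fun u v : 'I_s.+1 => v == u.+1 :> nat) ord0 ord_max
    (fun _ _ => 1).
Proof.
split=> // u.
have -> : \sum_(v < s.+1 | v == u.+1 :> nat) 1 = 1 - (u == ord_max)%:R :> R.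
  have [-> | u_max] := eqVneq u ord_max.
    by rewrite subrr big_pred0 // => v; rewrite ltn_eqF.
  have us : (u.+1 < s.+1)%N by rewrite ltnS ltn_neqAle u_max -ltnS ltn_ord.
  by rewrite subr0 (big_pred1 (Ordinal us)).
have -> : \sum_(v < s.+1 | u == v.+1 :> nat) 1 = 1 - (u == ord0)%:R :> R.
  case: (unliftP ord0 u) => [j ->|->]; last by rewrite subrr big_pred0.
  rewrite subr0 (big_pred1 (widen_ord (leqnSn s) j)) //.
by ring.
Qed.

(** * Labels of the path and their Hamming weights *)

Lemma hamming_setU1 (N : nat) (A : {set 'I_N}) (z : input N) (j : 'I_N) :
  j \notin A -> hamming (j |: A) z = (z j + hamming A z)%N.
Proof.
move=> jA; rewrite /hamming; case zj: (z j).
  have -> : [set i in j |: A | z i] = j |: [set i in A | z i].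
    apply/setP=> i; rewrite !inE; case: eqP => [->|] //=.
  by rewrite cardsU1 inE (negPf jA).
apply: eq_card => i; rewrite !inE; case: eqP => [->|] //=.
by rewrite zj andbF.
Qed.

Lemma eq_hamming (N : nat) (A : {set 'I_N}) (x y : input N) :
  {in A, x =1 y} -> hamming A x = hamming A y.
Proof.
by move=> xy; apply: eq_card => i; rewrite !inE; apply: andb_id2l => /xy ->.
Qed.

Definition path_label (N : nat) (S : {set 'I_N}) (n : nat) : {set 'I_N} :=
  [set i in take n (enum S)].

Lemma path_label0 (N : nat) (S : {set 'I_N}) : path_label N S 0 = set0.
Proof. by apply/setP=> i; rewrite !inE take0. Qed.

Lemma path_label_card (N : nat) (S : {set 'I_N}) : path_label N S #|S| = S.
Proof. by apply/setP=> i; rewrite inE cardE take_size mem_enum. Qed.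

Lemma path_labelS (N : nat) (S : {set 'I_N}) (n : nat) : (n < #|S|)%N ->
  exists2 j, j \notin path_label N S n
    & path_label N S n.+1 = j |: path_label N S n.
Proof.
(* [j0] only serves as the default value of [nth]. *)
move=> nS; have j0 := enum_val (Ordinal nS).
have tkS : take n.+1 (enum S) = rcons (take n (enum S)) (nth j0 (enum S) n).
  by rewrite (take_nth j0) // -cardE.
exists (nth j0 (enum S) n).
  have := take_uniq n.+1 (enum_uniq (mem S)).
  by rewrite tkS rcons_uniq inE => /andP[].
by apply/setP=> i; rewrite !inE tkS mem_rcons in_cons.
Qed.

Lemma hamming_path_labelS (N : nat) (S : {set 'I_N}) (z : input N) (n : nat) :
  (n < #|S|)%N ->
  (hamming (path_label N S n) z <= hamming (path_label N S n.+1) z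
    <= (hamming (path_label N S n) z).+1)%N.
Proof.
move=> /path_labelS[j jA ->]; rewrite hamming_setU1 // leq_addl /=.
by rewrite -add1n leq_add2r leq_b1.
Qed.

Lemma path_edge_lt (s : nat) (u v : 'I_s.+1) : v == u.+1 :> nat -> (u < s)%N.
Proof. by move=> /eqP uv; rewrite -ltnS -uv. Qed.

(** * Construction of the super edge *)

Definition sparse_load_graph (R : realType) (N : nat) (S : {set 'I_N}) :
  learningGraph R N.
Proof.
refine (@LearningGraph R N 'I_#|S|.+1 (fun u v => v == u.+1 :> nat) ord0
  (fun u => path_label N S u)
  (fun z b u v => sparse_weight R #|S| (hamming (path_label N S u) z)
     (hamming (path_label N S v) z) b)
  _ _ _ _ _ _ _).
(* Vertex indices increase along edges, so no path leads back from [v] to [u]. *)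
- move=> u v /eqP uv; apply/connectP => -[p pth ulast].
  suff : (v <= u)%N by rewrite uv ltnn.
  rewrite {uv}ulast; elim: p v pth => //= w p IHp v /andP[/eqP wv /IHp].
  by apply: leq_trans; rewrite wv.
- case=> v; elim: v => [|v IHv] vS; first by apply: eq_connect0; apply: val_inj.
  apply: connect_trans (IHv (ltnW vS)) (connect1 _) => //=.
- exact: path_label0.
- by move=> u v uv; rewrite (eqP uv); apply: path_labelS; apply: path_edge_lt uv.
- move=> z b u v /path_edge_lt us; apply/ltW/sparse_weight_gt0.
  exact: leq_ltn_trans us.
- move=> x y b u v uv xy; rewrite (eq_hamming _ _ _ _ xy) (eq_hamming _ _ x y) //.
  have [j _ vU] := path_labelS _ _ _ (path_edge_lt _ _ _ uv).
  by move=> i iu; apply: xy; rewrite (eqP uv) vU inE iu orbT.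
(* The counts before the edge agree and the bits read are opposite, so [x] with [false] and [y] with
   [true] select the same branch of [sparse_weight]. *)
- move=> x y u v j uv vU xy xyj.
  have ju : j \notin path_label N S u by apply: contra xyj => /xy ->.
  rewrite vU !hamming_setU1 // (eq_hamming _ _ _ _ xy) /sparse_weight.
  by case: (x j) (y j) xyj => [] [] //= _; rewrite ?add0n ?add1n ltnn ltnSn.
Defined.

Definition sparse_load (R : realType) (N : nat) (S : {set 'I_N}) :
  superEdge R S.
Proof.
refine (@SuperEdge R N S (sparse_load_graph R N S) ord_max (fun _ _ _ => 1)
  _ _ _).
- exact: path_label_card.
- by move=> z; apply: path_unit_flow.
(* No edge has weight 0: its existence forces [S] to be nonempty. *)
- move=> z u v /path_edge_lt us /eqP; rewrite gt_eqF //=.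
  by apply: sparse_weight_gt0; apply: leq_ltn_trans us.
Defined.

(** * The two complexities *)

Lemma neg_complexity_sparse_load (R : realType) (N : nat) (S : {set 'I_N})
    (z : input N) :
  neg_complexity (sparse_load R N S) z =
  \sum_(i < #|S|) sparse_weight R #|S| (hamming (path_label N S i) z)
    (hamming (path_label N S i.+1) z) false.
Proof.
exact: (sum_path_edges R #|S| (fun i j =>
  sparse_weight R #|S| (hamming (path_label N S i) z)
    (hamming (path_label N S j) z) false)).
Qed.

Lemma pos_complexity_sparse_load (R : realType) (N : nat) (S : {set 'I_N})
    (z : input N) :
  pos_complexity (sparse_load R N S) z =
  \sum_(i < #|S|) (sparse_weight R #|S| (hamming (path_label N S i) z)
    (hamming (path_label N S i.+1) z) true)^-1.
Proof.
rewrite -(sum_path_edges R #|S| (fun i j =>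
  (sparse_weight R #|S| (hamming (path_label N S i) z)
    (hamming (path_label N S j) z) true)^-1)).
by apply: eq_bigr => e _; rewrite /= expr1n mul1r.
Qed.

Theorem lemma3p8 (R : realType) (N : nat) (hN : (0 < N)%N) (S : {set 'I_N}) :
  exists SparseLoad : superEdge R S, forall z : input N,
    neg_complexity SparseLoad z
      <= 6 * #|S|%:R * ((hamming S z)%:R + 1) * ln (#|S|%:R + 1) /\
    pos_complexity SparseLoad z <= 1.
Proof.
exists (sparse_load R N S) => z.
rewrite neg_complexity_sparse_load pos_complexity_sparse_load.
(* For empty [S] there are no edges and both complexities vanish. *)
have [S0 | S0] := posnP #|S|.
  by rewrite S0 !big_ord0 mulr0 !mul0r.
have kS : (hamming S z <= #|S|)%N.
  by apply/subset_leq_card/subsetP => i; rewrite inE => /andP[].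
pose h n := hamming (path_label N S n) z.
have h0 : h 0%N = 0%N.
  by rewrite /h path_label0 /hamming (_ : [set _ in _ | _] = set0) ?cards0 //;
    apply/setP=> i; rewrite !inE.
have hS n : (n < #|S|)%N -> (h n <= h n.+1 <= (h n).+1)%N.
  exact: hamming_path_labelS.
have := sum_sparse_weight_neg R _ _ _ S0 h0 hS.
have := sum_sparse_weight_pos R _ _ _ S0 h0 hS.
have -> : h #|S| = hamming S z by rewrite /h path_label_card.
have s0 : 0 < #|S|%:R :> R by rewrite ltr0n.
have L0 := ln_succ_gt0 R _ S0.
set k := hamming S z in kS *.
have k1 : 0 < k%:R + 1 :> R by rewrite ltr_wpDl.
have lnk : ln (k%:R + 1) <= ln (#|S|%:R + 1) :> R.
  by rewrite ler_ln ?posrE ?lerD2r ?ler_nat // addr_gt0.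
move=> pos neg; split.
  apply: le_trans neg _.
  (* This absorbs the cost [2 #|S| k] of the ones into the logarithmic term, whence the constant 6 =
     4 + 2. *)
  have kL : k%:R <= (k%:R + 1) * ln (#|S|%:R + 1) :> R.
    have := ler_wpM2l (ltW k1) (le_trans (ln_ge_1BV _ _ k1) lnk).
    by rewrite mulrBr divff ?gt_eqF //; lra.
  have := ler_wpM2l (ltW s0) kL; lra.
apply: le_trans pos _.
have -> : #|S|%:R / (2 * #|S|%:R) = 2^-1 :> R by field; rewrite gt_eqF.
have : ln (k%:R + 1) / (2 * ln (#|S|%:R + 1)) <= 2^-1 :> R.
  by rewrite ler_pdivrMr ?mulr_gt0 //; lra.
lra.
Qed.
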